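(* Let $\Pi=\big((\alpha_1,\beta_1),\ldots,(\alpha_\mu,\beta_\mu)\big)$ be a finite sequence of pairs of nonempty words over the alphabet $\mathcal{A}$, and let $P_\Pi$ be the associated iterative propositional calculus. Then $\Pi\downarrow$ (the Post correspondence problem for $\Pi$ has a solution) if and only if $P_\Pi\vdash (x\to x)$.
   Context: Formulas are built from a countably infinite set $\mathcal{V}$ of propositional variables with the single binary connective $\to$; $x,y,p$ are fixed distinct variables. For a finite set $P$ of formulas, $P\vdash A$ means $A$ is derivable from $P$ by finitely many applications of: modus ponens (from $A$ and $A\to B$ infer $B$) and superposition (the Maltsev operations: from $A(x)$ and $B$, where $x$ is any variable, infer $A(B)$, obtained by replacing all occurrences of $x$ in $A$ by the already derived formula $B$; and renaming/identification of variables: from $A(x)$ infer $A(y)$ for any variables $x,y$). The iterative propositional calculus with axiom set $P$ is $P$ with these rules. Let $\mathcal{A}=\{a_1,\ldots,a_m\}$ be a finite alphabet with at least two letters, $\mathcal{A}^+$ the set of nonempty words over it. $\Pi\downarrow$ means there exist $N\ge 1$ and $i_1,\ldots,i_N\in\{1,\ldots,\mu\}$ with $\alpha_{i_1}\cdots\alpha_{i_N}=\beta_{i_1}\cdots\beta_{i_N}$. Coding. For a formula $F$ put $F\to_1 F:=(F\to F)\to F$ and $F\to_{i+1}F:=(F\to_i F)\to F$ for $i\ge1$. The code of the letter $a_i$ is $\overline{a}_i[x]:=x\to\big((p\to_i p)\to(p\to p)\big)$; for a formula $F$, $\overline{a}_i[F]$ denotes the result of replacing $x$ by $F$. For a word $\alpha=\beta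 b$ with $\beta\in\mathcal{A}^+$, $b\in\mathcal{A}$, put $\overline{\alpha}[x]:=\overline{\beta}[\overline{b}[x]]$; for the empty word $\overline{\varepsilon}[x]:=x$. The calculus $P_\Pi$ has the axioms: $(\mathrm{A_1})$ $\overline{a}_i[x]$ for all $i\in\{1,\ldots,m\}$; $(\mathrm{A_2})$ $\big(\overline{\alpha}_j[x]\to\overline{\beta}_j[y]\big)\to(x\to y)$ for all $j\in\{1,\ldots,\mu\}$, where $\overline{\alpha}_j,\overline{\beta}_j$ are the codes of the words $\alpha_j,\beta_j$; $(\mathrm{A_3})$ $\overline{a}_i[x]\to\overline{a}_i[x]$ for all $i\in\{1,\ldots,m\}$. *)

(* Defs.v *)
From HB Require Import structures.
From mathcomp Require Import all_boot.

Set Implicit Arguments.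
Unset Strict Implicit.
Unset Printing Implicit Defensive.

(* The countably infinite set of propositional variables is nat. *)
Inductive formula : Type :=
| Var of nat
| Imp of formula & formula.

Declare Scope formula_scope.
Delimit Scope formula_scope with F.
Bind Scope formula_scope with formula.
Notation "A ~> B" := (Imp A B) (at level 60, right associativity) :
  formula_scope.
Local Open Scope formula_scope.

Lemma formula_eq_dec : comparable formula.
Proof. by rewrite /comparable /decidable; decide equality; exact: eq_comparable. Qed.

HB.instance Definition _ := hasDecEq.Build formula (compareP formula_eq_dec).

(* All occurrences of the variable v in A are replaced by B. *)
Fixpoint subst (v : nat) (B A : formula) : formula :=
  match A with
  | Var w => if w == v then B else Var w
  | A1 ~> A2 => subst v B A1 ~> subst v B A2
  end.

(* In the superposition rule the substituted formula B must itself be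
   derivable; arbitrary substitution instances are not available. *)
Inductive derivable (P : seq formula) : formula -> Prop :=
| derivable_axiom A : A \in P -> derivable P A
| derivable_mp A B : derivable P A -> derivable P (A ~> B) -> derivable P B
| derivable_superposition v A B :
    derivable P A -> derivable P B -> derivable P (subst v B A)
| derivable_rename v w A : derivable P A -> derivable P (subst v (Var w) A).

(* F ->_i F, extended to i = 0 by F ->_0 F := F -> F, so that
   F ->_1 F = (F -> F) -> F. Only i >= 1 is used in the coding. *)
Fixpoint imp_iter (i : nat) (F : formula) : formula :=
  match i with
  | 0 => F ~> F
  | j.+1 => imp_iter j F ~> F
  end.

Section Coding.

Variables (m : nat) (x y p : nat).

(* The letters a_1, ..., a_m are indexed from 0: the element i of 'I_m stands
   for the letter a_(i+1). *)
Definition letter_code (i : 'I_m) : formula :=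
  Var x ~> (imp_iter i.+1 (Var p) ~> (Var p ~> Var p)).

(* The code of the empty word is x, and by foldl_rcons the code of (rcons w b)
   is the code of w with x replaced by the letter code of b. *)
Definition word_code (w : seq 'I_m) : formula :=
  foldl (fun C b => subst x (letter_code b) C) (Var x) w.

Definition PCP_axioms (mu : nat) (Pi : mu.-tuple (seq 'I_m * seq 'I_m)) :
    seq formula :=
  [seq letter_code i | i <- enum 'I_m] ++
  [seq (word_code (tnth Pi j).1 ~> subst x (Var y) (word_code (tnth Pi j).2))
         ~> (Var x ~> Var y) | j <- enum 'I_mu] ++
  [seq letter_code i ~> letter_code i | i <- enum 'I_m].

End Coding.

Definition PCP_solvable (m mu : nat) (Pi : mu.-tuple (seq 'I_m * seq 'I_m)) :
    Prop :=
  exists2 s : seq 'I_mu, s != [::] &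
    flatten [seq (tnth Pi i).1 | i <- s] = flatten [seq (tnth Pi i).2 | i <- s].

(* Main.v *)
Require Import Defs.
From mathcomp Require Import all_boot.

(** Write [marker i P] for [(P ->_(i+1) P) -> (P -> P)].  A letter code is an
implication into a marker, so the code of a word is a tower of such
implications, which can be read back in only one way: a marker is never itself
a letter code, and it determines its index ([letter_inj], [marker_not_letter]).

A solution of the correspondence problem gives a derivation.  Codes of nonempty
words are derivable, so they, as well as variables, may be substituted in the
axioms.  The third group of axioms yields the implication from the code of the
common word to itself, and each use of the second group cancels one pair
[(alpha_j, beta_j)] on both sides, until [x -> x] is left
([derivable_of_solution]).

For the converse, formulas are interpreted by a predicate [sound] that holds of
the variables, and holds of [U -> V] when it passes from [U] to [V] and,
in addition, [U -> V] is [traceable]: if [V] is the code of a word [v] on a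
variable, then so is [U] for some word [w], and a sequence [s] of pairs
satisfies [top s ++ w = bot s ++ v], with [s] and [w] not both empty; here
[top s] and [bot s] concatenate the first and the second words of the pairs in
[s].  Soundness is preserved by modus ponens by construction.  Superposition and
renaming only substitute derivable formulas and variables, so they preserve
validity, which is soundness under all substitutions of sound formulas
([derivable_valid]).  Since [x] is the code of the empty word on both sides,
traceability of [x -> x] is a solution.

The one delicate point is that markers become derivable (detach them from
letter codes), and so do instances of the second group whose conclusion
[X -> Y] is accidentally a letter code.  Hence [traceable] has to accept some
implications from a formula that is not a code at all to a code on a variable.
It does so only if the premise is [inert], that is, neither a variable nor a
letter code, and the conclusion is not a bare variable.  The first restriction
makes the exception disappear when a pair of nonempty words is cancelled; the
second refutes [u ->_i u] for a variable [u], and so keeps [marker i u] sound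
although [u -> u] need not be. *)

Set Implicit Arguments.
Unset Strict Implicit.
Unset Printing Implicit Defensive.

Local Open Scope formula_scope.

(** * Unique readability of codes *)

Definition marker (i : nat) (P : formula) : formula :=
  imp_iter i.+1 P ~> (P ~> P).

Lemma imp_iter_not_arg i P : imp_iter i P <> P.
Proof.
(* The number of connectives is the measure that separates the two. *)
pose fix size F := if F is A ~> B then (size A + size B).+1 else 0.
have size_iter j : size P < size (imp_iter j P).
  by elim: j => [|j IHj] /=; rewrite ltnS leq_addl.
by move=> E; move: (size_iter i); rewrite E ltnn.
Qed.

Lemma imp_iter_inj P : injective (imp_iter ^~ P).
Proof.
elim=> [|i IHi] [|j] //= [].
- by move=> E; case: (imp_iter_not_arg (esym E)).
- by move=> E; case: (imp_iter_not_arg E).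
- by move=> /IHi ->.
Qed.

Lemma letter_inj F G i j P Q :
  F ~> marker i P = G ~> marker j Q -> F = G /\ i = j.
Proof. by case=> -> E eqPQ _; split=> //; move: E; rewrite eqPQ => /imp_iter_inj. Qed.

(** Both readings would make [Q ->_(j+1) Q] equal to [Q -> Q]. *)
Lemma marker_not_letter i P G j Q : marker i P <> G ~> marker j Q.
Proof. by case=> _ -> E; have := @imp_iter_inj Q j.+1 0 E. Qed.

(** * Substitution in codes of words *)

(** Generalizes [word_code] to arbitrary formulas in place of the variables
[p] and [x]. *)
Definition code m (P : formula) (w : seq 'I_m) (F : formula) : formula :=
  foldr (fun (i : 'I_m) G => G ~> marker i P) F w.

Lemma code_cat m P (u w : seq 'I_m) F :
  code P (u ++ w) F = code P u (code P w F).
Proof. exact: foldr_cat. Qed.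

Lemma subst_imp_iter v B i P :
  subst v B (imp_iter i P) = imp_iter i (subst v B P).
Proof. by elim: i => //= i ->. Qed.

Lemma subst_code m v B P (w : seq 'I_m) F :
  subst v B (code P w F) = code (subst v B P) w (subst v B F).
Proof. by elim: w => //= i w ->; rewrite subst_imp_iter. Qed.

Lemma word_codeE m x p (w : seq 'I_m) :
  p != x -> word_code x p w = code (Var p) w (Var x).
Proof.
move=> npx; elim/last_ind: w => // w b IHw.
rewrite -cats1 code_cat /word_code foldl_cat -/(word_code x p w) IHw /=.
by rewrite subst_code /= (negPf npx) eqxx.
Qed.

Fixpoint inst (sigma : nat -> formula) (F : formula) : formula :=
  match F with
  | Var v => sigma v
  | A ~> B => inst sigma A ~> inst sigma B
  end.

Lemma inst_subst sigma v B F :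
  inst sigma (subst v B F) =
  inst (fun w => if w == v then inst sigma B else sigma w) F.
Proof. by elim: F => [w|A IHA C IHC] /=; [case: eqP | rewrite IHA IHC]. Qed.

Lemma inst_Var F : inst Var F = F.
Proof. by elim: F => //= A -> B ->. Qed.

Lemma inst_imp_iter sigma i P :
  inst sigma (imp_iter i P) = imp_iter i (inst sigma P).
Proof. by elim: i => //= i ->. Qed.

Lemma inst_code m sigma P (w : seq 'I_m) F :
  inst sigma (code P w F) = code (inst sigma P) w (inst sigma F).
Proof. by elim: w => //= i w ->; rewrite inst_imp_iter. Qed.

Section Calculus.

Variables (m : nat) (x y p : nat).
Hypothesis hxyp : uniq [:: x; y; p].
Variables (mu : nat) (Pi : mu.-tuple (seq 'I_m * seq 'I_m)).
Hypothesis hPi : forall j, (tnth Pi j).1 != [::] /\ (tnth Pi j).2 != [::].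

Let top (s : seq 'I_mu) := flatten [seq (tnth Pi j).1 | j <- s].
Let bot (s : seq 'I_mu) := flatten [seq (tnth Pi j).2 | j <- s].

Let distinct : [/\ (x == y) = false, (p == x) = false & (p == y) = false].
Proof.
move: hxyp; rewrite /= !inE negb_or andbT -andbA [p == x]eq_sym [p == y]eq_sym.
by case/and3P; do 3 move/negPf->.
Qed.
Let nxy : (x == y) = false. Proof. by case: distinct. Qed.
Let npx : (p == x) = false. Proof. by case: distinct. Qed.
Let npy : (p == y) = false. Proof. by case: distinct. Qed.

Definition pair_axiom (j : 'I_mu) : formula :=
  (code (Var p) (tnth Pi j).1 (Var x) ~> code (Var p) (tnth Pi j).2 (Var y))
    ~> (Var x ~> Var y).

Lemma PCP_axiomsP F :
  F \in PCP_axioms x y p Pi <->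
  [\/ exists i : 'I_m, F = code (Var p) [:: i] (Var x),
      exists j, F = pair_axiom j
    | exists i : 'I_m,
        F = code (Var p) [:: i] (Var x) ~> code (Var p) [:: i] (Var x)].
Proof.
have pairE j : (word_code x p (tnth Pi j).1 ~>
    subst x (Var y) (word_code x p (tnth Pi j).2)) ~> (Var x ~> Var y)
  = pair_axiom j.
  by rewrite !word_codeE ?npx // subst_code /= npx eqxx.
rewrite /PCP_axioms !mem_cat; split.
- case/or3P=> /mapP [i _ ->]; [by constructor 1; exists i | |
    by constructor 3; exists i].
  by constructor 2; exists i; rewrite pairE.
- case=> [] [i ->]; apply/or3P.
  + by constructor 1; apply/mapP; exists i; rewrite ?mem_enum.
  + by constructor 2; apply/mapP; exists i; rewrite ?mem_enum // pairE.
  + by constructor 3; apply/mapP; exists i; rewrite ?mem_enum.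
Qed.

(** * From a solution to a derivation *)

Local Notation "'|-' A" := (derivable (PCP_axioms x y p Pi) A) (at level 70).
Local Notation wcode w := (@code m (Var p) w (Var x)).

(** The formulas allowed in substitutions by superposition and renaming. *)
Definition substitutable (B : formula) : Prop := |- B \/ exists v, B = Var v.

Lemma derivable_subst v A B : |- A -> substitutable B -> |- subst v B A.
Proof.
move=> dA [dB|[w ->]]; first exact: derivable_superposition.
exact: derivable_rename.
Qed.

Lemma wcode_substitutable w : substitutable (wcode w).
Proof.
elim: w => [|i w IHw]; first by right; exists x.
left; have -> : wcode (i :: w) = subst x (wcode w) (wcode [:: i]).
  by rewrite subst_code /= npx eqxx.
apply: derivable_subst => //; apply: derivable_axiom.
by apply/PCP_axiomsP; constructor 1; exists i.
Qed.

Lemma derivable_wcode_refl w : w != [::] -> |- wcode w ~> wcode w.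
Proof.
case: w => // i w _.
have -> : wcode (i :: w) ~> wcode (i :: w) =
    subst x (wcode w) (wcode [:: i] ~> wcode [:: i]).
  by rewrite /= !subst_imp_iter /= npx eqxx.
apply: derivable_subst (wcode_substitutable w); apply: derivable_axiom.
by apply/PCP_axiomsP; constructor 3; exists i.
Qed.

Lemma derivable_cancel j u w :
  |- wcode ((tnth Pi j).1 ++ u) ~> wcode ((tnth Pi j).2 ++ w) ->
  |- wcode u ~> wcode w.
Proof.
move/derivable_mp; apply.
have : |- subst y (wcode w) (subst x (wcode u) (pair_axiom j)).
  do 2 ![apply: derivable_subst; last exact: wcode_substitutable].
  by apply: derivable_axiom; apply/PCP_axiomsP; constructor 2; exists j.
rewrite !code_cat /pair_axiom /= !subst_code /=.
rewrite eqxx [y == x]eq_sym nxy npx.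
by rewrite !subst_code /= npy nxy eqxx.
Qed.

Lemma derivable_of_solution : PCP_solvable Pi -> |- Var x ~> Var x.
Proof.
case=> s s_n0 eq_s.
have : |- wcode (top s) ~> wcode (bot s).
  rewrite /top /bot -eq_s; apply: derivable_wcode_refl.
  case: s s_n0 {eq_s} => //= j s _.
  by case: (hPi j); case: (tnth Pi j).1.
elim: s {s_n0 eq_s} => [|j s IHs] //= /derivable_cancel.
exact: IHs.
Qed.

(** * From a derivation to a solution *)

Fixpoint codes_var (w : seq 'I_m) (F : formula) : Prop :=
  if w is i :: w' then exists G P, F = G ~> marker i P /\ codes_var w' G
  else exists v, F = Var v.

Definition inert (U : formula) : Prop :=
  (forall v, U <> Var v) /\ (forall i G P, U <> G ~> marker i P).

Lemma codes_var_code P (u w : seq 'I_m) F : codes_var w F -> codes_var (u ++ w) (code P u F).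
Proof. by elim: u => //= i u IHu /IHu cF; exists (code P u F), P. Qed.

Lemma codes_var_code_inv P (u w : seq 'I_m) F :
  codes_var w (code P u F) -> exists2 w', w = u ++ w' & codes_var w' F.
Proof.
elim: u w => [|i u IHu] w /=; first by exists w.
case: w => [[]|j w] //= [G [Q [/letter_inj [<- /val_inj <-] /IHu [w' -> cF]]]].
by exists w'.
Qed.

Lemma code_not_inert P (u : seq 'I_m) F : u != [::] -> ~ inert (code P u F).
Proof. by case: u => //= i u _ [_ /(_ i (code P u F) P)]. Qed.

Lemma marker_not_codes_var i P w : ~ codes_var w (marker i P).
Proof. by case: w => [[]|j w] //= [G [Q [/marker_not_letter]]]. Qed.

(** If [P -> P] is a letter code, then [P] is a marker, and so not the code of a
word on a variable. *)
Lemma refl_not_codes_var P w : ~ codes_var w (P ~> P).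
Proof.
case: w => [[]|j w] //= [G [Q [[<- ->]]]].
exact: marker_not_codes_var.
Qed.

(** The second alternative admits the instances of [pair_axiom] whose conclusion
is a letter code. *)
Definition traceable (U V : formula) : Prop :=
  forall v, codes_var v V ->
    (exists w s, [/\ codes_var w U, top s ++ w = bot s ++ v
                   & (s != [::]) || (w != [::])])
    \/ (inert U /\ v != [::]).

Fixpoint sound (F : formula) : Prop :=
  if F is U ~> V then traceable U V /\ (sound U -> sound V) else True.

Lemma traceable_refl w F : codes_var w F -> w != [::] -> traceable F F.
Proof.
move=> cF w_n0 v cv; left; exists v, [::]; split=> //.
(* [F] is an implication because [w] is nonempty, so [v] is nonempty too. *)
by case: v cv => // [[n E]]; case: w cF w_n0 => //= i w [G [P []]]; rewrite E.
Qed.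

Lemma sound_marker i P : sound (marker i P).
Proof.
split=> [v /refl_not_codes_var //|soundPi].
split=> // -[|j v] cP; last exact: (traceable_refl cP).
(* For a variable P the premise is refuted: its conclusion is a bare variable,
   and its own premise ends in that variable, so it is not a code. *)
case: soundPi => trace _; case: cP => u EP.
case: (trace [::]) => [||[_ //]]; first by exists u.
case=> w [s [cPi _ _]]; rewrite {}EP in cPi.
by case: w cPi => [[n]|j w [G [Q []]]]; case: (i).
Qed.

Lemma sound_code P (w : seq 'I_m) F : sound F -> sound (code P w F).
Proof.
by case: w => //= i w _; split=> [v /marker_not_codes_var|_] //; exact: sound_marker.
Qed.

Lemma traceable_cancel j P X Y :
  traceable (code P (tnth Pi j).1 X) (code P (tnth Pi j).2 Y) -> traceable X Y.
Proof.
move=> trace v /(@codes_var_code P (tnth Pi j).2) /trace [].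
- case=> w [s [/codes_var_code_inv [w' -> cX] eq_s _]].
  left; exists w', (rcons s j); split=> //; last by case: (s).
  by rewrite /top /bot !map_rcons !flatten_rcons -!catA.
- by case=> /code_not_inert; case: (hPi j) => n0 _ /(_ n0).
Qed.

Lemma code_imp_inert P (u : seq 'I_m) F G :
  u != [::] -> inert (F ~> code P u G).
Proof.
case: u => // i u _; split=> // j H R.
by move/(congr1 (fun A => if A is _ ~> B then B else A))/esym/marker_not_letter.
Qed.

Definition valid (F : formula) : Prop :=
  forall sigma, (forall v, sound (sigma v)) -> sound (inst sigma F).

Lemma axiom_valid F : F \in PCP_axioms x y p Pi -> valid F.
Proof.
move=> /PCP_axiomsP axF sigma sound_sigma.
case: axF => [] [i ->].
- by rewrite inst_code; apply: sound_code; exact: sound_sigma.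
- rewrite /pair_axiom /= !inst_code /=; split=> [v cv|[trace _]].
    right; split; first by apply: code_imp_inert; case: (hPi i).
    by case: v cv => [[]|].
  by split=> [|_ //]; exact: traceable_cancel trace.
- rewrite [inst _ _]/= inst_imp_iter; split=> //= v cv.
  by apply: (traceable_refl cv) (cv); case: v cv => [[]|].
Qed.

Lemma derivable_valid F : |- F -> valid F.
Proof.
elim=> {F} [F /axiom_valid //|A B _ vA _ vB|v A B _ vA _ vB|v w A _ vA]
  sigma sound_sigma.
- by case: (vB _ sound_sigma) => _; apply; exact: vA.
- by rewrite inst_subst; apply: vA => u; case: eqP => // _; exact: vB.
- by rewrite inst_subst; apply: vA => u; case: eqP => // _; exact: sound_sigma.
Qed.

Lemma solution_of_derivable : |- Var x ~> Var x -> PCP_solvable Pi.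
Proof.
move=> /derivable_valid /(_ Var (fun=> I)) [/(_ [::])].
case=> [||[_ //]]; first by exists x.
case=> -[|i w] [s [cw eq_s]]; last by case: cw => G [P []].
rewrite orbF => s_n0 _; exists s => //.
by move: eq_s; rewrite !cats0.
Qed.

End Calculus.

Theorem mainTheorem3 (m : nat) (hm : 1 < m)
    (x y p : nat) (hxyp : uniq [:: x; y; p])
    (mu : nat) (Pi : mu.-tuple (seq 'I_m * seq 'I_m))
    (hPi : forall j : 'I_mu, (tnth Pi j).1 != [::] /\ (tnth Pi j).2 != [::]) :
  PCP_solvable Pi <->
  derivable (PCP_axioms x y p Pi) (Imp (Var x) (Var x)).
Proof.
split; first exact: derivable_of_solution.
exact: solution_of_derivable.
Qed.
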